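(* Let $n\ge1$, let $\mathcal T$ be a triangulated category and let $\mathcal X=\operatorname{add}\mathcal X$ be a functorially finite $n$-rigid subcategory of $\mathcal T$. Then the canonical pretriangulated quotient $\mathcal T/[\mathcal X]$ is $n$-truncated if and only if $\mathcal X$ is $(n+1)$ cluster tilting.
   Context: Subcategories are full and closed under isomorphisms; $\mathcal X=\operatorname{add}\mathcal X$ means closed under finite direct sums and direct summands. $[1]$ is the shift of $\mathcal T$. $\mathcal X$ is $n$-rigid if $\mathcal T(X,X'[i])=0$ for all $X,X'\in\mathcal X$ and $1\le i\le n$. $\mathcal X$ is functorially finite if every $A\in\mathcal T$ admits a left $\mathcal X$-approximation (a morphism $A\to X_A$, $X_A\in\mathcal X$, through which every morphism from $A$ to an object of $\mathcal X$ factors) and, dually, a right $\mathcal X$-approximation $X^A\to A$. $\mathcal X$ is $(n+1)$ cluster tilting if it is functorially finite and $$\mathcal X=\{A\mid\mathcal T(A,X[i])=0\ \forall X\in\mathcal X,\ 1\le i\le n\}=\{A\mid\mathcal T(X,A[i])=0\ \forall X\in\mathcal X,\ 1\le i\le n\}.$$ $\mathcal T/[\mathcal X]$ is the ideal quotient by the morphisms factoring through objects of $\mathcal X$, with quotient functor $\pi_{\mathcal X}$. Its canonical pretriangulated structure has suspension $\Sigma_{\mathcal X}$ given by $\Sigma_{\mathcal X}(\pi_{\mathcal X}A)=\pi_{\mathcal X}(A^+)$, where $A\to X_A\to A^+\to A[1]$ is a chosen distinguished triangle whose first morphism is a left $\mathcal X$-approximation (on morphisms: complete $f:A\to B$ to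 a morphism $(f,g,h)$ of the chosen triangles and take $\pi_{\mathcal X}h$), and loop $\Omega_{\mathcal X}$ defined dually from distinguished triangles $A^-\to X^A\to A\to A^-[1]$ whose second morphism is a right $\mathcal X$-approximation; $\Sigma_{\mathcal X}$ is left adjoint to $\Omega_{\mathcal X}$. A pretriangulated category with suspension $\Sigma$ and loop $\Omega$ is $n$-truncated if $\Sigma^n\cong\mathbf 0$ (the zero endofunctor), equivalently $\Omega^n\cong\mathbf 0$. *)

(* Defs.v *)
Set Warnings "-notation-overridden,-ambiguous-paths,-redundant-canonical-projection".
From HB Require Import structures.
From mathcomp Require Import all_boot all_algebra.
From mathcomp Require Import boolp.

Set Implicit Arguments.
Unset Strict Implicit.
Unset Printing Implicit Defensive.

Import GRing.Theory.
Local Open Scope ring_scope.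
Local Open Scope quotient_scope.

Local Obligation Tactic := idtac.

Reserved Notation "g \oc f" (at level 40, left associativity).

Record preadditive := Preadditive {
  ob :> Type;
  hom : ob -> ob -> zmodType;
  idm : forall A, hom A A;
  comp : forall A B C, hom B C -> hom A B -> hom A C;
  comp1m : forall A B (f : hom A B), comp (idm B) f = f;
  compm1 : forall A B (f : hom A B), comp f (idm A) = f;
  compA : forall A B C D (h : hom C D) (g : hom B C) (f : hom A B),
    comp h (comp g f) = comp (comp h g) f;
  compDl : forall A B C (g g' : hom B C) (f : hom A B),
    comp (g + g') f = comp g f + comp g' f;
  compDr : forall A B C (g : hom B C) (f f' : hom A B),
    comp g (f + f') = comp g f + comp g f' }.

Arguments hom {p} A B.
Arguments idm {p} A.
Arguments comp {p A B C} g f.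
Notation "g \oc f" := (comp g f).

Definition is_iso (C : preadditive) (A B : C) (f : hom A B) : Prop :=
  exists g : hom B A, g \oc f = idm A /\ f \oc g = idm B.

Definition isomorphic (C : preadditive) (A B : C) : Prop :=
  exists f : hom A B, is_iso f.

Definition is_zero (C : preadditive) (Z : C) : Prop :=
  (forall A (f : hom Z A), f = 0) /\ (forall A (f : hom A Z), f = 0).

Definition is_biproduct (C : preadditive) (A B M : C) : Prop :=
  exists (i1 : hom A M) (i2 : hom B M) (p1 : hom M A) (p2 : hom M B),
    [/\ p1 \oc i1 = idm A, p2 \oc i2 = idm B, p1 \oc i2 = 0, p2 \oc i1 = 0
      & i1 \oc p1 + i2 \oc p2 = idm M].

Record additive := Additive {
  preadditive_of :> preadditive;
  zero_ob : preadditive_of;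
  zero_obP : is_zero zero_ob;
  biproductP : forall A B : preadditive_of, exists M, is_biproduct A B M }.

Arguments zero_ob : clear implicits.

Section PreadditiveTheory.
Variable C : preadditive.

Lemma comp0m (A B D : C) (f : hom A B) : (0 : hom B D) \oc f = 0.
Proof. by apply: (addrI ((0 : hom B D) \oc f)); rewrite -compDl !addr0. Qed.

Lemma compm0 (A B D : C) (g : hom B D) : g \oc (0 : hom A B) = 0.
Proof. by apply: (addrI (g \oc (0 : hom A B))); rewrite -compDr !addr0. Qed.

Lemma compNm (A B D : C) (g : hom B D) (f : hom A B) : (- g) \oc f = - (g \oc f).
Proof. by apply: (addrI (g \oc f)); rewrite -compDl !subrr comp0m. Qed.

Lemma compmN (A B D : C) (g : hom B D) (f : hom A B) : g \oc (- f) = - (g \oc f).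
Proof. by apply: (addrI (g \oc f)); rewrite -compDr !subrr compm0. Qed.

Lemma compBl (A B D : C) (g g' : hom B D) (f : hom A B) :
  (g - g') \oc f = g \oc f - g' \oc f.
Proof. by rewrite compDl compNm. Qed.

Lemma compBr (A B D : C) (g : hom B D) (f f' : hom A B) :
  g \oc (f - f') = g \oc f - g \oc f'.
Proof. by rewrite compDr compmN. Qed.

End PreadditiveTheory.

Record additive_functor (C D : preadditive) := AdditiveFunctor {
  fobj :> C -> D;
  fmap : forall A B, hom A B -> hom (fobj A) (fobj B);
  fmap1 : forall A, fmap (idm A) = idm (fobj A);
  fmapM : forall A B E (g : hom B E) (f : hom A B),
    fmap (g \oc f) = fmap g \oc fmap f;
  fmapD : forall A B (f g : hom A B), fmap (f + g) = fmap f + fmap g }.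

Arguments fmap {C D} F {A B} f : rename.

Lemma fmap0 (C D : preadditive) (F : additive_functor C D) (A B : C) :
  fmap F (0 : hom A B) = 0.
Proof. by apply: (addrI (fmap F (0 : hom A B))); rewrite -fmapD !addr0. Qed.

Lemma fmapN (C D : preadditive) (F : additive_functor C D) (A B : C)
  (f : hom A B) : fmap F (- f) = - fmap F f.
Proof. by apply: (addrI (fmap F f)); rewrite -fmapD !subrr fmap0. Qed.

Lemma fmapB (C D : preadditive) (F : additive_functor C D) (A B : C)
  (f g : hom A B) : fmap F (f - g) = fmap F f - fmap F g.
Proof. by rewrite fmapD fmapN. Qed.

Definition id_functor (C : preadditive) : additive_functor C C :=
  @AdditiveFunctor C C (fun A => A) (fun A B f => f)
    (fun A => erefl) (fun A B E g f => erefl) (fun A B f g => erefl).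

Program Definition comp_functor (C D E : preadditive)
    (G : additive_functor D E) (F : additive_functor C D)
  : additive_functor C E :=
  @AdditiveFunctor C E (fun A => G (F A)) (fun A B f => fmap G (fmap F f)) _ _ _.
Next Obligation. by move=> * /=; rewrite !fmap1. Qed.
Next Obligation. by move=> * /=; rewrite !fmapM. Qed.
Next Obligation. by move=> * /=; rewrite !fmapD. Qed.

Program Definition zero_functor (C : preadditive) (D : additive)
  : additive_functor C D :=
  @AdditiveFunctor C D (fun _ => zero_ob D) (fun A B f => 0) _ _ _.
Next Obligation. by move=> C D A /=; rewrite ((zero_obP D).1 _ (idm _)). Qed.
Next Obligation. by move=> * /=; rewrite comp0m. Qed.
Next Obligation. by move=> * /=; rewrite addr0. Qed.

Fixpoint iter_functor (C : preadditive) (n : nat) (F : additive_functor C C)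
  : additive_functor C C :=
  if n is m.+1 then comp_functor F (iter_functor m F) else id_functor C.

Definition natural_iso (C D : preadditive) (F G : additive_functor C D) : Prop :=
  exists eta : forall A, hom (F A) (G A),
    (forall A, is_iso (eta A)) /\
    (forall A B (f : hom A B), eta B \oc fmap F f = fmap G f \oc eta A).

Definition is_equivalence (C D : preadditive) (F : additive_functor C D) : Prop :=
  exists G : additive_functor D C,
    natural_iso (comp_functor G F) (id_functor C) /\
    natural_iso (comp_functor F G) (id_functor D).

Definition left_adjoint (C D : preadditive)
    (F : additive_functor C D) (G : additive_functor D C) : Prop :=
  exists phi : forall A B, hom (F A) B -> hom A (G B),
    (forall A B, bijective (@phi A B)) /\
    (forall A A' B B' (a : hom A' A) (b : hom B B') (h : hom (F A) B),
      phi A' B' (b \oc h \oc fmap F a) = fmap G b \oc phi A B h \oc a).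

Definition triangle_morphism (C : preadditive) (S : additive_functor C C)
    (A B D A' B' D' : C)
    (u : hom A B) (v : hom B D) (w : hom D (S A))
    (u' : hom A' B') (v' : hom B' D') (w' : hom D' (S A'))
    (a : hom A A') (b : hom B B') (d : hom D D') : Prop :=
  [/\ b \oc u = u' \oc a, d \oc v = v' \oc b & fmap S a \oc w = w' \oc d].

Record triangulated := Triangulated {
  additive_of :> additive;
  shift : additive_functor additive_of additive_of;
  shift_equiv : is_equivalence shift;
  dist : forall A B C : additive_of,
    hom A B -> hom B C -> hom C (shift A) -> Prop;
  dist_iso : forall (A B C A' B' C' : additive_of)
    (u : hom A B) (v : hom B C) (w : hom C (shift A))
    (u' : hom A' B') (v' : hom B' C') (w' : hom C' (shift A'))
    (a : hom A A') (b : hom B B') (c : hom C C'),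
    triangle_morphism u v w u' v' w' a b c ->
    is_iso a -> is_iso b -> is_iso c -> dist u v w -> dist u' v' w';
  dist_id : forall A : additive_of,
    dist (idm A) (0 : hom A (zero_ob additive_of)) 0;
  dist_cone : forall (A B : additive_of) (u : hom A B),
    exists C (v : hom B C) (w : hom C (shift A)), dist u v w;
  dist_rot : forall (A B C : additive_of)
    (u : hom A B) (v : hom B C) (w : hom C (shift A)),
    dist u v w <-> dist v w (- fmap shift u);
  dist_fill : forall (A B C A' B' C' : additive_of)
    (u : hom A B) (v : hom B C) (w : hom C (shift A))
    (u' : hom A' B') (v' : hom B' C') (w' : hom C' (shift A'))
    (a : hom A A') (b : hom B B'),
    dist u v w -> dist u' v' w' -> b \oc u = u' \oc a ->
    exists c : hom C C', triangle_morphism u v w u' v' w' a b c;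
  dist_oct : forall (X Y Z X' Y' Z' : additive_of)
    (u : hom X Y) (j : hom Y Z') (k : hom Z' (shift X))
    (v : hom Y Z) (l : hom Z X') (i : hom X' (shift Y))
    (m : hom Z Y') (n : hom Y' (shift X)),
    dist u j k -> dist v l i -> dist (v \oc u) m n ->
    exists (f : hom Z' Y') (g : hom Y' X'),
      [/\ dist f g (fmap shift j \oc i),
          n \oc f = k, g \oc m = l, f \oc j = m \oc v
        & i \oc g = fmap shift u \oc n] }.

Arguments shift {t}.
Arguments dist {t A B C} u v w.

Record add_subcategory (C : additive) := AddSubcategory {
  subob :> C -> Prop;
  subob_iso : forall A B : C, isomorphic A B -> subob A -> subob B;
  subob_zero : subob (zero_ob C);
  subob_sum : forall A B M : C,
    is_biproduct A B M -> subob A -> subob B -> subob M;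
  subob_summand : forall A B M : C, is_biproduct A B M -> subob M -> subob A }.

Section Subcategory.
Variables (T : triangulated) (X : add_subcategory T).

Definition rigid (n : nat) : Prop :=
  forall A B : T, X A -> X B -> forall i, (1 <= i <= n)%N ->
  forall f : hom A (iter i shift B), f = 0.

Definition left_approx (A M : T) (a : hom A M) : Prop :=
  X M /\ forall N (f : hom A N), X N -> exists g : hom M N, f = g \oc a.

Definition right_approx (M A : T) (b : hom M A) : Prop :=
  X M /\ forall N (f : hom N A), X N -> exists g : hom N M, f = b \oc g.

Definition functorially_finite : Prop :=
  (forall A, exists M (a : hom A M), left_approx a) /\
  (forall A, exists M (b : hom M A), right_approx b).

Definition cluster_tilting (m : nat) : Prop :=
  [/\ functorially_finite,
      forall A, X A <-> (forall B i, X B -> (1 <= i < m)%N ->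
        forall f : hom A (iter i shift B), f = 0)
    & forall A, X A <-> (forall B i, X B -> (1 <= i < m)%N ->
        forall f : hom B (iter i shift A), f = 0)].

End Subcategory.

Section IdealQuotient.
Variables (C : additive) (X : add_subcategory C).

Definition factors_through (A B : C) (f : hom A B) : Prop :=
  exists2 M, X M & exists (s : hom A M) (t : hom M B), f = t \oc s.

Definition ideal (A B : C) : {pred hom A B} :=
  fun f => `[< factors_through f >].
Arguments ideal : clear implicits.

Lemma idealP (A B : C) (f : hom A B) :
  reflect (factors_through f) (f \in ideal A B).
Proof. exact: asboolP. Qed.

Lemma ideal_zmod_closed (A B : C) : zmod_closed (ideal A B).
Proof.
split=> [|f g /idealP [M XM [s [t ->]]] /idealP [N XN [s' [t' ->]]]].
  apply/idealP; exists (zero_ob C); first exact: subob_zero.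
  by exists 0, 0; rewrite comp0m.
have [P [i1 [i2 [p1 [p2 [p1i1 p2i2 p1i2 p2i1 ip]]]]]] := biproductP M N.
apply/idealP; exists P; first by apply: subob_sum XM XN; exists i1, i2, p1, p2.
exists (i1 \oc s + i2 \oc s'), (t \oc p1 - t' \oc p2).
rewrite compDr !compBl -!compA (compA p1) (compA p2) (compA p1) (compA p2).
by rewrite p1i1 p2i2 p1i2 p2i1 !comp1m !comp0m !compm0 subr0 sub0r.
Qed.

HB.instance Definition _ (A B : C) :=
  GRing.isZmodClosed.Build (hom A B) (ideal A B) (ideal_zmod_closed A B).

Lemma ideal_compl (A B D : C) (g : hom B D) (f : hom A B) :
  f \in ideal A B -> g \oc f \in ideal A D.
Proof.
move=> /idealP [M XM [s [t ->]]]; apply/idealP; exists M => //.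
by exists s, (g \oc t); rewrite compA.
Qed.

Lemma ideal_compr (A B D : C) (g : hom B D) (f : hom A B) :
  g \in ideal B D -> g \oc f \in ideal A D.
Proof.
move=> /idealP [M XM [s [t ->]]]; apply/idealP; exists M => //.
by exists (s \oc f), t; rewrite compA.
Qed.

Definition qhom (A B : C) : zmodType := {ideal_quot (ideal A B)}.

Definition qpi (A B : C) (f : hom A B) : qhom A B := \pi_({ideal_quot (ideal A B)}) f.

Definition qrepr (A B : C) (f : qhom A B) : hom A B :=
  repr (f : {ideal_quot (ideal A B)}).

Lemma qreprK (A B : C) (f : qhom A B) : qpi (qrepr f) = f.
Proof. exact: reprK. Qed.

Lemma qpi_eq (A B : C) (f g : hom A B) :
  qpi f = qpi g <-> f - g \in ideal A B.
Proof.
rewrite (Quotient.idealrBE (ideal A B)); split; first by move/eqP.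
by move/eqP.
Qed.

Lemma qpiD (A B : C) (f g : hom A B) : qpi (f + g) = qpi f + qpi g.
Proof. by rewrite /qpi raddfD. Qed.

Lemma qpi0 (A B : C) : qpi (0 : hom A B) = 0.
Proof. by rewrite /qpi raddf0. Qed.

Lemma qrepr_pi (A B : C) (f : hom A B) : qrepr (qpi f) - f \in ideal A B.
Proof. by apply/qpi_eq; rewrite qreprK. Qed.

Definition qcomp (A B D : C) (g : qhom B D) (f : qhom A B) : qhom A D :=
  qpi (qrepr g \oc qrepr f).

Lemma qcomp_pi (A B D : C) (g : hom B D) (f : hom A B) :
  qcomp (qpi g) (qpi f) = qpi (g \oc f).
Proof.
apply/qpi_eq.
rewrite -(subrKA (g \oc qrepr (qpi f))) -compBl -compBr.
by apply: rpredD; [apply: ideal_compr | apply: ideal_compl]; apply: qrepr_pi.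
Qed.

Lemma qhom_ind (A B : C) (P : qhom A B -> Prop) :
  (forall f, P (qpi f)) -> forall f, P f.
Proof. by move=> Pf f; rewrite -(qreprK f). Qed.

Program Definition quotient_preadditive : preadditive :=
  @Preadditive C qhom (fun A => qpi (idm A)) qcomp _ _ _ _ _.
Next Obligation. by move=> A B; elim/qhom_ind => f; rewrite qcomp_pi comp1m. Qed.
Next Obligation. by move=> A B; elim/qhom_ind => f; rewrite qcomp_pi compm1. Qed.
Next Obligation.
move=> A B D E; elim/qhom_ind => h; elim/qhom_ind => g; elim/qhom_ind => f.
by rewrite !qcomp_pi compA.
Qed.
Next Obligation.
move=> A B D; elim/qhom_ind => g; elim/qhom_ind => g'; elim/qhom_ind => f.
by rewrite -qpiD !qcomp_pi compDl qpiD.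
Qed.
Next Obligation.
move=> A B D; elim/qhom_ind => g; elim/qhom_ind => f; elim/qhom_ind => f'.
by rewrite -qpiD !qcomp_pi compDr qpiD.
Qed.

Lemma quotient_zero : @is_zero quotient_preadditive (zero_ob C).
Proof.
split=> A; elim/qhom_ind => f; rewrite -[RHS]qpi0; congr (qpi _).
  exact: (zero_obP C).1.
exact: (zero_obP C).2.
Qed.

Lemma quotient_biproduct (A B : quotient_preadditive) :
  exists M, is_biproduct A B M.
Proof.
have [M [i1 [i2 [p1 [p2 [e1 e2 e3 e4 e5]]]]]] := @biproductP C A B.
exists M, (qpi i1), (qpi i2), (qpi p1), (qpi p2).
by rewrite /= !qcomp_pi -qpiD e1 e2 e3 e4 e5 !qpi0.
Qed.

Definition quotient : additive := Additive quotient_zero quotient_biproduct.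

Definition quotient_functor : additive_functor C quotient :=
  @AdditiveFunctor C quotient (fun A => A) qpi (fun A => erefl)
    (fun A B D g f => esym (qcomp_pi g f)) qpiD.

End IdealQuotient.

Arguments ideal {C} X A B.

Section FullyFaithful.
Variables (C D : preadditive) (F : additive_functor C D).
Hypothesis F_equiv : is_equivalence F.

Lemma equivalence_faithful (A B : C) : injective (@fmap C D F A B).
Proof.
case: F_equiv => G [[eta [eta_iso etaN]] _] f g fg.
have /= Ef := etaN _ _ f; have /= Eg := etaN _ _ g.
have [e [_ etaK]] := eta_iso A.
by rewrite -(compm1 f) -(compm1 g) -etaK !compA -Ef -Eg fg.
Qed.

End FullyFaithful.

Lemma equivalence_full (C D : preadditive) (F : additive_functor C D)
    (A B : C) (g : hom (F A) (F B)) :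
  is_equivalence F -> exists f : hom A B, fmap F f = g.
Proof.
move=> [G [GF FG]].
have G_equiv : is_equivalence G by exists F.
case: GF => eta [eta_iso etaN].
have [e [eK Ke]] := eta_iso A; have [e' [e'K Ke']] := eta_iso B.
exists (eta B \oc fmap G g \oc e); apply: (equivalence_faithful G_equiv).
have E : eta B \oc fmap G (fmap F (eta B \oc fmap G g \oc e)) =
         eta B \oc fmap G g.
  by rewrite (etaN _ _ (eta B \oc fmap G g \oc e)) /= -!compA eK compm1.
by rewrite -[LHS]comp1m -[RHS]comp1m -e'K -!(compA e') E.
Qed.

Record triangle (T : triangulated) := Triangle {
  tob1 : T; tob2 : T; tob3 : T;
  tmap1 : hom tob1 tob2; tmap2 : hom tob2 tob3; tmap3 : hom tob3 (shift tob1);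
  tdist : dist tmap1 tmap2 tmap3 }.

Definition triangle_hom (T : triangulated) (s t : triangle T)
    (a : hom (tob1 s) (tob1 t)) (b : hom (tob2 s) (tob2 t))
    (c : hom (tob3 s) (tob3 t)) : Prop :=
  triangle_morphism (tmap1 s) (tmap2 s) (tmap3 s)
                    (tmap1 t) (tmap2 t) (tmap3 t) a b c.

Definition completes (T : triangulated) (s t : triangle T)
    (a : hom (tob1 s) (tob1 t)) (c : hom (tob3 s) (tob3 t)) : Prop :=
  exists b, triangle_hom a b c.

Section TriangleTheory.
Variable T : triangulated.

Lemma dist_comp12 (A B C : T) (u : hom A B) (v : hom B C)
  (w : hom C (shift A)) : dist u v w -> v \oc u = 0.
Proof.
move=> d; have [|c [_ + _]] := dist_fill (a := idm A) (b := u) (dist_id A) d.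
  by [].
by rewrite compm0.
Qed.

Lemma dist_comp23 (A B C : T) (u : hom A B) (v : hom B C)
  (w : hom C (shift A)) : dist u v w -> w \oc v = 0.
Proof. by move=> /dist_rot /dist_comp12. Qed.

Lemma dist_comp31 (A B C : T) (u : hom A B) (v : hom B C)
  (w : hom C (shift A)) : dist u v w -> fmap shift u \oc w = 0.
Proof.
by move=> /dist_rot /dist_comp23 /eqP; rewrite compNm oppr_eq0 => /eqP.
Qed.

Lemma dist_lift (A B C D : T) (u : hom A B) (v : hom B C)
    (w : hom C (shift A)) (c : hom D C) :
  dist u v w -> w \oc c = 0 -> exists d : hom D B, c = v \oc d.
Proof.
move=> d wc.
have d1 := (dist_rot _ _ _).1 (dist_id D).
have d2 := (dist_rot _ _ _).1 ((dist_rot _ _ _).1 d).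
have [|e [_ _]] := dist_fill (a := c) (b := 0) d1 d2.
  by rewrite wc compm0.
rewrite fmap1 compmN compm1 compNm => /oppr_inj.
have [f <-] := equivalence_full e (shift_equiv T).
rewrite -fmapM => /(equivalence_faithful (shift_equiv T)) ->.
by exists f.
Qed.

Lemma shift_zero : is_zero (shift (zero_ob T)).
Proof.
have id0 : idm (shift (zero_ob T)) = 0.
  by rewrite -fmap1 ((zero_obP T).1 _ (idm _)) fmap0.
split=> A f; first by rewrite -(compm1 f) id0 compm0.
by rewrite -(comp1m f) id0 comp0m.
Qed.

Lemma dist_zero_id (A : T) :
  dist (0 : hom (zero_ob T) A) (idm A) (0 : hom A (shift (zero_ob T))).
Proof.
apply/dist_rot.
apply: (dist_iso (a := idm A) (b := idm A)
  (c := (0 : hom (zero_ob T) (shift (zero_ob T)))) _ _ _ _ (dist_id A)).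
- by split; rewrite ?comp0m ?compm0 // fmap0 oppr0 comp0m.
- by exists (idm A); rewrite comp1m.
- by exists (idm A); rewrite comp1m.
- exists 0; rewrite !comp0m; split; apply/esym.
    exact: (zero_obP T).1.
  exact: shift_zero.1.
Qed.

Lemma dist_extend (A B C D : T) (u : hom A B) (v : hom B C)
    (w : hom C (shift A)) (f : hom A D) :
  dist u v w -> fmap shift f \oc w = 0 -> exists s : hom B D, f = s \oc u.
Proof.
move=> d fw.
have d2 := (dist_rot _ _ _).1 ((dist_rot _ _ _).1 d).
have [|e [_ + _]] := dist_fill (a := 0) (b := fmap shift f) d2
  (dist_zero_id (shift D)).
  by rewrite fw compm0.
have [s <-] := equivalence_full e (shift_equiv T).
rewrite compmN comp1m -fmapM -fmapN.
move=> /(equivalence_faithful (shift_equiv T)) <-.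
by exists (- s); rewrite compNm.
Qed.

Lemma dist_fill1 (A B C A' B' C' : T)
    (u : hom A B) (v : hom B C) (w : hom C (shift A))
    (u' : hom A' B') (v' : hom B' C') (w' : hom C' (shift A'))
    (b : hom B B') (c : hom C C') :
  dist u v w -> dist u' v' w' -> c \oc v = v' \oc b ->
  exists a : hom A A', triangle_morphism u v w u' v' w' a b c.
Proof.
move=> /dist_rot d /dist_rot d' cv.
have [a1 [e1 e2]] := dist_fill d d' cv.
have [a E] := equivalence_full a1 (shift_equiv T).
rewrite compmN compNm -E -!fmapM.
move=> /oppr_inj /(equivalence_faithful (shift_equiv T)) e3.
by exists a; split=> //; rewrite E.
Qed.

Lemma completes1 (s : triangle T) :
  completes (idm (tob1 s)) (idm (tob3 s)).
Proof.
by exists (idm (tob2 s)); split; rewrite ?fmap1 ?comp1m ?compm1.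
Qed.

Lemma completesM (s t r : triangle T)
    (a : hom (tob1 s) (tob1 t)) (c : hom (tob3 s) (tob3 t))
    (a' : hom (tob1 t) (tob1 r)) (c' : hom (tob3 t) (tob3 r)) :
  completes a c -> completes a' c' -> completes (a' \oc a) (c' \oc c).
Proof.
move=> [b [e1 e2 e3]] [b' [e1' e2' e3']]; exists (b' \oc b); split.
- by rewrite -compA e1 compA e1' -compA.
- by rewrite -compA e2 compA e2' -compA.
- by rewrite fmapM -compA e3 compA e3' -compA.
Qed.

Lemma completesD (s t : triangle T)
    (a a' : hom (tob1 s) (tob1 t)) (c c' : hom (tob3 s) (tob3 t)) :
  completes a c -> completes a' c' -> completes (a + a') (c + c').
Proof.
move=> [b [e1 e2 e3]] [b' [e1' e2' e3']]; exists (b + b'); split.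
- by rewrite compDl e1 e1' compDr.
- by rewrite compDl e2 e2' compDr.
- by rewrite fmapD compDl e3 e3' compDr.
Qed.

Lemma completesN (s t : triangle T)
    (a : hom (tob1 s) (tob1 t)) (c : hom (tob3 s) (tob3 t)) :
  completes a c -> completes (- a) (- c).
Proof.
move=> [b [e1 e2 e3]]; exists (- b).
by split; rewrite ?fmapN compNm compmN (e1, e2, e3).
Qed.

Variable X : add_subcategory T.

Lemma completes_right (s t : triangle T) (a : hom (tob1 s) (tob1 t)) :
  left_approx X (tmap1 s) -> X (tob2 t) ->
  exists c : hom (tob3 s) (tob3 t), completes a c.
Proof.
move=> [_ apx] Xt; have [b E] := apx _ (tmap1 t \oc a) Xt.
by have [c hc] := dist_fill (tdist s) (tdist t) (esym E); exists c, b.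
Qed.

Lemma completes_left (s t : triangle T) (c : hom (tob3 s) (tob3 t)) :
  right_approx X (tmap2 t) -> X (tob2 s) ->
  exists a : hom (tob1 s) (tob1 t), completes a c.
Proof.
move=> [_ apx] Xs; have [b E] := apx _ (c \oc tmap2 s) Xs.
by have [a ha] := dist_fill1 (tdist s) (tdist t) E; exists a, b.
Qed.

Lemma completes_ideal_right (s t : triangle T)
    (a : hom (tob1 s) (tob1 t)) (c : hom (tob3 s) (tob3 t)) :
  left_approx X (tmap1 s) -> X (tob2 t) -> completes a c ->
  a \in ideal X _ _ -> c \in ideal X _ _.
Proof.
move=> [_ apx] Xt [b [_ _ e3]] /idealP [M XM [p [q Ea]]].
have [g Ep] := apx _ p XM.
have tc : tmap3 t \oc c = 0.
  by rewrite -e3 Ea Ep !fmapM -!compA (dist_comp31 (tdist s)) !compm0.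
have [d ->] := dist_lift (tdist t) tc.
by apply/idealP; exists (tob2 t) => //; exists d, (tmap2 t).
Qed.

Lemma completes_ideal_left (s t : triangle T)
    (a : hom (tob1 s) (tob1 t)) (c : hom (tob3 s) (tob3 t)) :
  right_approx X (tmap2 t) -> X (tob2 s) -> completes a c ->
  c \in ideal X _ _ -> a \in ideal X _ _.
Proof.
move=> [_ apx] Xs [b [_ _ e3]] /idealP [M XM [p [q Ec]]].
have [g Eq] := apx _ q XM.
have sa : fmap shift a \oc tmap3 s = 0.
  by rewrite e3 Ec Eq !compA (dist_comp23 (tdist t)) !comp0m.
have [d ->] := dist_extend (tdist s) sa.
by apply/idealP; exists (tob2 s) => //; exists (tmap1 s), d.
Qed.

Lemma completes_qpi_right (s t : triangle T)
    (a a' : hom (tob1 s) (tob1 t)) (c c' : hom (tob3 s) (tob3 t)) :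
  left_approx X (tmap1 s) -> X (tob2 t) -> completes a c -> completes a' c' ->
  qpi X a = qpi X a' -> qpi X c = qpi X c'.
Proof.
move=> apx Xt h h' /qpi_eq aa'; apply/qpi_eq.
by apply: completes_ideal_right aa' => //; apply: completesD h (completesN h').
Qed.

Lemma completes_qpi_left (s t : triangle T)
    (a a' : hom (tob1 s) (tob1 t)) (c c' : hom (tob3 s) (tob3 t)) :
  right_approx X (tmap2 t) -> X (tob2 s) -> completes a c -> completes a' c' ->
  qpi X c = qpi X c' -> qpi X a = qpi X a'.
Proof.
move=> apx Xs h h' /qpi_eq cc'; apply/qpi_eq.
by apply: completes_ideal_left cc' => //; apply: completesD h (completesN h').
Qed.

End TriangleTheory.

(* A -> X_A -> A^+ -> A[1] *)
Record suspension_triangle (T : triangulated) (X : add_subcategory T) (A : T) :=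
  SuspensionTriangle {
    st_mid : T;
    st_plus : T;
    st_map1 : hom A st_mid;
    st_map2 : hom st_mid st_plus;
    st_map3 : hom st_plus (shift A);
    st_dist : dist st_map1 st_map2 st_map3;
    st_approx : left_approx X st_map1 }.

(* A^- -> X^A -> A -> A^-[1] *)
Record loop_triangle (T : triangulated) (X : add_subcategory T) (A : T) :=
  LoopTriangle {
    lt_minus : T;
    lt_mid : T;
    lt_map1 : hom lt_minus lt_mid;
    lt_map2 : hom lt_mid A;
    lt_map3 : hom A (shift lt_minus);
    lt_dist : dist lt_map1 lt_map2 lt_map3;
    lt_approx : right_approx X lt_map2 }.

Section SuspensionLoop.
Variables (T : triangulated) (X : add_subcategory T).
Variables (L : forall A, suspension_triangle X A).
Variables (R : forall A, loop_triangle X A).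

Local Notation Q := (quotient X).

Let tL (A : T) : triangle T := Triangle (st_dist (L A)).
Let tR (A : T) : triangle T := Triangle (lt_dist (R A)).
Let XL (A : T) : X (tob2 (tL A)) := (st_approx (L A)).1.
Let XR (A : T) : X (tob2 (tR A)) := (lt_approx (R A)).1.

Definition susp_map (A B : T) (f : hom A B)
  : hom (st_plus (L A)) (st_plus (L B)) :=
  sval (cid (@completes_right T X (tL A) (tL B) f (st_approx (L A)) (XL B))).

Lemma susp_mapP (A B : T) (f : hom A B) :
  @completes T (tL A) (tL B) f (susp_map f).
Proof. by rewrite /susp_map; case: cid. Qed.

Definition loop_map (A B : T) (f : hom A B)
  : hom (lt_minus (R A)) (lt_minus (R B)) :=
  sval (cid (@completes_left T X (tR A) (tR B) f (lt_approx (R B)) (XR A))).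

Lemma loop_mapP (A B : T) (f : hom A B) :
  @completes T (tR A) (tR B) (loop_map f) f.
Proof. by rewrite /loop_map; case: cid. Qed.

(* The arbitrary choices of representative and completion are immaterial, by
   suspension_fmapE and loop_fmapE. *)
Definition suspension_fmap (A B : Q) (f : hom A B)
  : @hom Q (st_plus (L A)) (st_plus (L B)) := qpi X (susp_map (qrepr f)).

Definition loop_fmap (A B : Q) (f : hom A B)
  : @hom Q (lt_minus (R A)) (lt_minus (R B)) := qpi X (loop_map (qrepr f)).

Lemma suspension_fmapE (A B : T) (f : hom A B)
    (h : hom (st_plus (L A)) (st_plus (L B))) :
  @completes T (tL A) (tL B) f h -> suspension_fmap (qpi X f) = qpi X h.
Proof.
move=> fh; apply: (@completes_qpi_right T X (tL A) (tL B)) fh _.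
- exact: st_approx.
- exact: XL.
- exact: susp_mapP.
- exact: qreprK.
Qed.

Lemma loop_fmapE (A B : T) (f : hom A B)
    (h : hom (lt_minus (R A)) (lt_minus (R B))) :
  @completes T (tR A) (tR B) h f -> loop_fmap (qpi X f) = qpi X h.
Proof.
move=> fh; apply: (@completes_qpi_left T X (tR A) (tR B)) fh _.
- exact: lt_approx.
- exact: XR.
- exact: loop_mapP.
- exact: qreprK.
Qed.

Program Definition suspension : additive_functor Q Q :=
  @AdditiveFunctor Q Q (fun A => st_plus (L A)) suspension_fmap _ _ _.
Next Obligation. by move=> A; apply: suspension_fmapE (completes1 (tL A)). Qed.
Next Obligation.
move=> A B D; elim/qhom_ind => g; elim/qhom_ind => f.
rewrite /= qcomp_pi (suspension_fmapE (susp_mapP f)).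
rewrite (suspension_fmapE (susp_mapP g)) qcomp_pi.
exact: suspension_fmapE (completesM (susp_mapP f) (susp_mapP g)).
Qed.
Next Obligation.
move=> A B; elim/qhom_ind => f; elim/qhom_ind => g.
rewrite -qpiD (suspension_fmapE (susp_mapP f)).
rewrite (suspension_fmapE (susp_mapP g)) -qpiD.
exact: suspension_fmapE (completesD (susp_mapP f) (susp_mapP g)).
Qed.

Program Definition loop : additive_functor Q Q :=
  @AdditiveFunctor Q Q (fun A => lt_minus (R A)) loop_fmap _ _ _.
Next Obligation. by move=> A; apply: loop_fmapE (completes1 (tR A)). Qed.
Next Obligation.
move=> A B D; elim/qhom_ind => g; elim/qhom_ind => f.
rewrite /= qcomp_pi (loop_fmapE (loop_mapP f)).
rewrite (loop_fmapE (loop_mapP g)) qcomp_pi.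
exact: loop_fmapE (completesM (loop_mapP f) (loop_mapP g)).
Qed.
Next Obligation.
move=> A B; elim/qhom_ind => f; elim/qhom_ind => g.
rewrite -qpiD (loop_fmapE (loop_mapP f)).
rewrite (loop_fmapE (loop_mapP g)) -qpiD.
exact: loop_fmapE (completesD (loop_mapP f) (loop_mapP g)).
Qed.

Lemma suspension_loop_adjoint : left_adjoint suspension loop.
Proof.
have toL (A B : T) (h : hom (st_plus (L A)) B) :
    exists f : hom A (lt_minus (R B)), @completes T (tL A) (tR B) f h.
  exact: (@completes_left T X (tL A) (tR B) h (lt_approx (R B)) (XL A)).
have toR (A B : T) (f : hom A (lt_minus (R B))) :
    exists h : hom (st_plus (L A)) B, @completes T (tL A) (tR B) f h.
  exact: (@completes_right T X (tL A) (tR B) f (st_approx (L A)) (XR B)).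
pose phi (A B : Q) (h : @hom Q (suspension A) B) : @hom Q A (loop B) :=
  qpi X (sval (cid (toL A B (qrepr h)))).
pose psi (A B : Q) (f : @hom Q A (loop B)) : @hom Q (suspension A) B :=
  qpi X (sval (cid (toR A B (qrepr f)))).
have phiE (A B : T) f h :
    @completes T (tL A) (tR B) f h -> phi A B (qpi X h) = qpi X f.
  move=> fh; rewrite /phi; case: cid => f' /= fh'.
  apply: (@completes_qpi_left T X (tL A) (tR B)) fh' fh _.
  - exact: lt_approx.
  - exact: XL.
  - exact: qreprK.
have psiE (A B : T) f h :
    @completes T (tL A) (tR B) f h -> psi A B (qpi X f) = qpi X h.
  move=> fh; rewrite /psi; case: cid => f' /= fh'.
  apply: (@completes_qpi_right T X (tL A) (tR B)) fh' fh _.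
  - exact: st_approx.
  - exact: XR.
  - exact: qreprK.
exists phi; split=> [A B|A A' B B'].
  exists (psi A B); elim/qhom_ind => f.
    by have [g fg] := toL _ _ f; rewrite (phiE _ _ _ _ fg) (psiE _ _ _ _ fg).
  by have [g fg] := toR _ _ f; rewrite (psiE _ _ _ _ fg) (phiE _ _ _ _ fg).
elim/qhom_ind => a; elim/qhom_ind => b; elim/qhom_ind => h.
have [f fh] := toL _ _ h.
rewrite /= (suspension_fmapE (susp_mapP a)) (loop_fmapE (loop_mapP b)).
rewrite (phiE _ _ _ _ fh) (qcomp_pi X b h) (qcomp_pi X (loop_map b) f) !qcomp_pi.
apply: phiE.
have bf := @completesM T (tL A) (tR B) (tR B') _ _ _ _ fh (loop_mapP b).
exact: (@completesM T (tL A') (tL A) (tR B') _ _ _ _ (susp_mapP a) bf).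
Qed.

End SuspensionLoop.

(* Of a pretriangulated structure, only the underlying additive category and
   the adjoint pair (Sigma, Omega) are recorded: the classes of left and right
   triangles play no role in being n-truncated. *)
Record suspension_loop_category := SuspensionLoopCategory {
  slc_additive :> additive;
  slc_suspension : additive_functor slc_additive slc_additive;
  slc_loop : additive_functor slc_additive slc_additive;
  slc_adjoint : left_adjoint slc_suspension slc_loop }.

Definition truncated (n : nat) (C : suspension_loop_category) : Prop :=
  natural_iso (iter_functor n (slc_suspension C)) (zero_functor C C).

Definition pretriangulated_quotient (T : triangulated) (X : add_subcategory T)
    (L : forall A, suspension_triangle X A) (R : forall A, loop_triangle X A)
  : suspension_loop_category :=
  SuspensionLoopCategory (suspension_loop_adjoint L R).

Lemma suspension_triangle_exists (T : triangulated) (X : add_subcategory T) :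
  functorially_finite X -> forall A, inhabited (suspension_triangle X A).
Proof.
move=> [+ _] A => /(_ A) [M [a apx]].
have [B [b [c d]]] := dist_cone a.
by split; exists M B a b c.
Qed.

Lemma dist_cocone (T : triangulated) (B C : T) (v : hom B C) :
  exists A (u : hom A B) (w : hom C (shift A)), dist u v w.
Proof.
have [D [w [z d]]] := dist_cone v.
have [G [_ [eps [eps_iso _]]]] := shift_equiv T.
have [e [eK Ke]] := eps_iso D; rewrite /= in e eK Ke.
have [u Eu] := @equivalence_full T T shift (G D) B (- (z \oc eps D)) (shift_equiv T).
exists (G D), u, (e \oc w); apply/dist_rot.
apply: (dist_iso (a := idm B) (b := idm C) (c := e) _ _ _ _ d).
- by split; rewrite ?comp1m ?compm1 // Eu opprK fmap1 comp1m -compA Ke compm1.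
- by exists (idm B); rewrite comp1m.
- by exists (idm C); rewrite comp1m.
- by exists (eps D).
Qed.

Lemma loop_triangle_exists (T : triangulated) (X : add_subcategory T) :
  functorially_finite X -> forall A, inhabited (loop_triangle X A).
Proof.
move=> [_ +] A => /(_ A) [M [b apx]].
have [B [a [c d]]] := dist_cocone b.
by split; exists B M a b c.
Qed.

(* Main.v *)
From mathcomp Require Import all_boot.
From mathcomp Require Import ssralg.
Require Import Defs.

(** Write [A^+] for the third vertex of a suspension triangle
    [A -> X_A -> A^+ -> A[1]], and [A^-] for the first vertex of a loop triangle.
    The zero objects of the ideal quotient are the objects of [X], because [X]
    is closed under direct summands and a retract of an object of a triangulated
    category is a direct summand ([subob_retract], [subob_quotient_zero]).  So
    the quotient is [n]-truncated exactly when the [n]-fold suspension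
    [A^{+...+}] lies in [X] for every [A] ([truncatedP]).  The theorem is then a
    matter of moving the vanishing of [T(A, X[i])] and of [T(X, A[i])] along
    approximation triangles, where [n]-rigidity makes the middle terms of the
    long exact sequences vanish.

    - If [X] is [(n+1)] cluster tilting: each suspension gains one degree of
      vanishing.  [T(A^+, X[i+1])] is controlled by [T(A, X[i])], and
      [T(A^+, X[1]) = 0] since [A -> X_A] is a left approximation.  Hence
      [T(Sigma^n A, X[i]) = 0] for [1 <= i <= n], so [Sigma^n A] lies in [X]
      ([suspension_left_perp]).

    - If [Sigma^n = 0] and [T(A, X[i]) = 0] for [1 <= i <= n]: as
      [T(A, X[1]) = 0], the loop triangle of [A] is also a suspension triangle of
      [A^-], so [A] is isomorphic to [Sigma A^-] in the quotient, and [A^-] still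
      satisfies the vanishing in one degree less.  Iterating, [A] is in the
      essential image of [Sigma^n], hence is zero in the quotient
      ([left_perp_suspension]).

    - If [Sigma^n = 0] and [T(X, A[i]) = 0] for [1 <= i <= n]: the suspension
      [A^+] satisfies the vanishing in one degree less, and as [T(X, A[1]) = 0],
      [A^+] in [X] forces [A -> X_A] to be a split monomorphism, so [A] is in
      [X].  Descending from [Sigma^n A] to [A], the latter lies in [X]
      ([right_perp_subob]). *)

Set Implicit Arguments.
Unset Strict Implicit.
Unset Printing Implicit Defensive.

Import GRing.Theory.
Local Open Scope ring_scope.

(** * Exactness properties of distinguished triangles *)

Section Triangles.
Variable T : triangulated.

Lemma dist_cokernel (A B C D : T) (u : hom A B) (v : hom B C)
    (w : hom C (shift A)) (f : hom B D) :
  dist u v w -> f \oc u = 0 -> exists s : hom C D, f = s \oc v.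
Proof.
move=> /dist_rot d fu; apply: (dist_extend d).
by rewrite compmN -fmapM fu fmap0 oppr0.
Qed.

Lemma dist_split (A B C : T) (u : hom A B) (v : hom B C)
    (w : hom C (shift A)) :
  dist u v w -> w = 0 -> exists t : hom B A, t \oc u = idm A.
Proof.
move=> d w0.
have [|t ->] := dist_extend (f := idm A) d; last by exists t.
by rewrite w0 compm0.
Qed.

(** The complement of a retract is the cone of its inclusion: the connecting
    morphism of that cone is killed by [s[1]], which has a left inverse, so it
    vanishes and the triangle splits. *)
Lemma retract_biproduct (A M : T) (s : hom A M) (t : hom M A) :
  t \oc s = idm A -> exists C : T, is_biproduct A C M.
Proof.
move=> ts; have [C [v [w d]]] := dist_cone s.
have w0 : w = 0.
  by rewrite -(comp1m w) -fmap1 -ts fmapM -compA (dist_comp31 d) compm0.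
have [|e ve] := dist_lift (c := idm C) d; first by rewrite w0 comp0m.
have [|g Eg] := dist_cokernel (f := idm M - s \oc t) d.
  by rewrite compBl comp1m -compA ts compm1 subrr.
(* The section e of v need not be killed by t, but its correction g is. *)
have Eg' : g = (idm M - s \oc t) \oc e by rewrite Eg -compA -ve compm1.
exists C, s, g, t, v; split=> //.
- by rewrite Eg' compA compBr compm1 compA (dist_comp12 d) comp0m subr0.
- by rewrite Eg' compA compBr compm1 compA ts comp1m subrr comp0m.
- exact: dist_comp12 d.
- by rewrite -Eg addrC subrK.
Qed.

Lemma dist_shift (A B C : T) (u : hom A B) (v : hom B C)
    (w : hom C (shift A)) :
  dist u v w -> dist (- fmap shift u) (- fmap shift v) (- fmap shift w).
Proof. by move=> d; do 3!apply: (dist_rot _ _ _).1. Qed.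

(** Stating the existence of some triangle on the shifted vertices, rather than
    a formula for its maps, avoids comparing [A[1][i]] with [A[i][1]]. *)
Lemma dist_iter_shift (A B C : T) (u : hom A B) (v : hom B C)
    (w : hom C (shift A)) (i : nat) :
  dist u v w ->
  exists (u' : hom (iter i shift A) (iter i shift B))
    (v' : hom (iter i shift B) (iter i shift C))
    (w' : hom (iter i shift C) (iter i.+1 shift A)), dist u' v' w'.
Proof.
move=> d; elim: i => [|i [u' [v' [w' d']]]]; first by exists u, v, w.
by exists (- fmap shift u'), (- fmap shift v'), (- fmap shift w');
  apply: dist_shift.
Qed.

End Triangles.

(** * Vanishing conditions and approximations *)

Section Perpendicular.
Variables (T : triangulated) (X : add_subcategory T).

Definition left_perp (m : nat) (A : T) : Prop :=
  forall B i, X B -> (1 <= i < m)%N ->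
  forall f : hom A (iter i shift B), f = 0.

Definition right_perp (m : nat) (A : T) : Prop :=
  forall B i, X B -> (1 <= i < m)%N ->
  forall f : hom B (iter i shift A), f = 0.

Lemma subob_retract (A M : T) (s : hom A M) (t : hom M A) :
  t \oc s = idm A -> X M -> X A.
Proof. by move=> /retract_biproduct [C]; apply: subob_summand. Qed.

Lemma subob_quotient_zero (A : T) : X A <-> idm (A : quotient X) = 0.
Proof.
rewrite -[RHS](qpi0 X A A) /= qpi_eq subr0; split=> [XA|].
  by apply/idealP; exists A => //; exists (idm A), (idm A); rewrite comp1m.
by move=> /idealP [M XM [s [t E]]]; apply: (subob_retract (esym E)).
Qed.

Lemma subob_quotient_iso (A B : quotient X) : isomorphic A B -> X A -> X B.
Proof.
move=> [f [g [_ fg]]] /subob_quotient_zero A0; apply/subob_quotient_zero.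
by rewrite -fg -(compm1 f) A0 compm0 comp0m.
Qed.

Section Triangle.
Variables (A M C : T) (u : hom A M) (v : hom M C) (w : hom C (shift A)).
Hypothesis d : dist u v w.

(** Degree [1] of [C] comes for free from the approximation property, and degree
    [i + 1] from degree [i] of [A]. *)
Lemma left_perp_third (n m : nat) :
  rigid X n -> left_approx X u -> (m < n)%N ->
  left_perp m.+1 A -> left_perp m.+2 C.
Proof.
move=> Xn [XM apx] mn Am B [//|i] XB im f.
have fv : f \oc v = 0 by apply: Xn => //; apply: leq_trans mn.
have [g ->] := dist_cokernel ((dist_rot _ _ _).1 d) fv.
have [g' <-] := equivalence_full g (shift_equiv T).
case: i g' {f fv g} im => [|i] g' im.
  have [h ->] := apx _ g' XB.
  by rewrite fmapM -compA (dist_comp31 d) compm0.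
by rewrite (Am B i.+1 XB _ g') // fmap0 comp0m.
Qed.

(** The obstruction to extending [f : A -> N] to [M] is the composite
    [C -> A[1] -> N[1]]. *)
Lemma left_perp_left_approx : X M -> left_perp 2 C -> left_approx X u.
Proof.
move=> XM C2; split=> // N f XN; apply: (dist_extend d).
exact: (C2 N 1%N).
Qed.

Lemma left_perp_first (n m : nat) :
  rigid X n -> X M -> (m <= n)%N -> left_perp m.+2 C -> left_perp m.+1 A.
Proof.
move=> Xn XM mn Cm B i XB /andP [i0 im] f.
have [|s ->] := dist_extend (f := f) d; first exact: (Cm B i.+1).
by rewrite (Xn M B XM XB i _ s) ?comp0m // i0 (leq_trans _ mn).
Qed.

Lemma right_perp_third (n m : nat) :
  rigid X n -> X M -> (m <= n)%N -> right_perp m.+2 A -> right_perp m.+1 C.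
Proof.
move=> Xn XM mn Am B i XB /andP [i0 im] f.
have [u' [v' [w' d']]] := dist_iter_shift i d.
have [|e ->] := dist_lift (c := f) d'; first exact: (Am B i.+1).
by rewrite (Xn B M XB XM i _ e) ?compm0 // i0 (leq_trans _ mn).
Qed.

(** The connecting morphism [C -> A[1]] starts in [X], so it vanishes and [A] is
    a retract of [M]. *)
Lemma right_perp_first : X M -> right_perp 2 A -> X C -> X A.
Proof.
move=> XM A2 XC; have w0 : w = 0 by apply: (A2 C 1%N).
by have [t tu] := dist_split d w0; apply: subob_retract tu XM.
Qed.

End Triangle.
End Perpendicular.

(** * Iterated suspensions in the quotient *)

Lemma fmap_isomorphic (C D : preadditive) (F : additive_functor C D) (A B : C) :
  isomorphic A B -> isomorphic (F A) (F B).
Proof.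
move=> [f [g [gf fg]]]; exists (fmap F f), (fmap F g).
by rewrite -!fmapM gf fg !fmap1.
Qed.

Lemma isomorphic_trans (C : preadditive) (A B D : C) :
  isomorphic A B -> isomorphic B D -> isomorphic A D.
Proof.
move=> [f [f' [f'f ff']]] [g [g' [g'g gg']]]; exists (g \oc f), (f' \oc g').
split.
  by rewrite compA -(compA f') g'g compm1.
by rewrite compA -(compA g) ff' compm1.
Qed.

Lemma iter_functorSr (C : preadditive) (F : additive_functor C C) (n : nat)
    (A : C) :
  iter_functor n.+1 F A = iter_functor n F (F A).
Proof. by elim: n => //= n <-. Qed.

Section Suspension.
Variables (T : triangulated) (X : add_subcategory T) (n : nat).
Hypothesis X_rigid : rigid X n.
Variable L : forall A : T, suspension_triangle X A.
Variable R : forall A : T, loop_triangle X A.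

Local Notation Sigma := (suspension L).

Lemma truncatedP (m : nat) :
  truncated m (pretriangulated_quotient L R) <->
  (forall A : T, X (iter_functor m Sigma A)).
Proof.
split=> [[eta [eta_iso _]] A|XS].
  apply/subob_quotient_zero.
  have [e [<- _]] := eta_iso A.
  by rewrite ((zero_obP (quotient X)).1 _ e) comp0m.
exists (fun A => 0); split=> [A|A B f]; last by rewrite compm0 comp0m.
exists 0; rewrite !comp0m; split; apply/esym.
  exact/subob_quotient_zero/XS.
exact: (zero_obP (quotient X)).1.
Qed.

(** Between two triangles on left approximations of [A], completing [idm A] both
    ways gives mutually inverse morphisms in the quotient, since completions are
    unique there. *)
Lemma suspension_unique (A M C : T) (u : hom A M) (v : hom M C)
    (w : hom C (shift A)) :
  dist u v w -> left_approx X u -> isomorphic (Sigma A) (C : quotient X).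
Proof.
move=> d apx; pose s := Triangle (st_dist (L A)); pose t := Triangle d.
have apxs : left_approx X (tmap1 s) := st_approx (L A).
have [c hc] : exists c, @completes T s t (idm A) c.
  exact: (@completes_right T X s t (idm A) apxs apx.1).
have [c' hc'] : exists c', @completes T t s (idm A) c'.
  exact: (@completes_right T X t s (idm A) apx apxs.1).
exists (qpi X c), (qpi X c'); split; rewrite /= qcomp_pi.
  have h := @completesM T s t s _ _ _ _ hc hc'.
  apply: (@completes_qpi_right T X s s _ _ _ _ apxs apxs.1 h (completes1 s)).
  by rewrite comp1m.
have h := @completesM T t s t _ _ _ _ hc' hc.
apply: (@completes_qpi_right T X t t _ _ _ _ apx apx.1 h (completes1 t)).
by rewrite comp1m.
Qed.

Lemma suspension_left_perp (m : nat) (A : T) :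
  (m <= n)%N -> left_perp X m.+1 (iter_functor m Sigma A).
Proof.
elim: m => [_ B [|i]|m IHm mn] //.
exact: (left_perp_third (st_dist (L _)) X_rigid (st_approx _) mn (IHm (ltnW mn))).
Qed.

Lemma left_perp_suspension (m : nat) (A : T) :
  (m <= n)%N -> left_perp X m.+1 A ->
  exists B : T, isomorphic (iter_functor m Sigma B) (A : quotient X).
Proof.
elim: m A => [|m IHm] A mn Am.
  by exists A, (idm (A : quotient X)), (idm (A : quotient X)); rewrite comp1m.
have d := lt_dist (R A); have XM := (lt_approx (R A)).1.
have [B isoB] := IHm _ (ltnW mn)
  (left_perp_first d X_rigid XM (ltnW mn) Am).
exists B; apply: isomorphic_trans (fmap_isomorphic Sigma isoB) _.
apply: (suspension_unique d); apply: (left_perp_left_approx d XM).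
by move=> D i XD /andP [i0 i2]; apply: Am; rewrite // i0 (leq_trans i2).
Qed.

Lemma right_perp_subob (m : nat) (A : T) :
  (m <= n)%N -> right_perp X m.+1 A -> X (iter_functor m Sigma A) -> X A.
Proof.
elim: m A => [//|m IHm] A mn Am; rewrite iter_functorSr => XS.
have d := st_dist (L A); have XM := (st_approx (L A)).1.
apply: (right_perp_first d XM).
  by move=> D i XD /andP [i0 i2]; apply: Am; rewrite // i0 (leq_trans i2).
exact: (IHm _ (ltnW mn) (right_perp_third d X_rigid XM (ltnW mn) Am) XS).
Qed.

End Suspension.

Theorem corollary1p3 (T : triangulated) (n : nat) (hn : (1 <= n)%N)
    (X : add_subcategory T) (X_ff : functorially_finite X) (X_rigid : rigid X n)
    (L : forall A : T, suspension_triangle X A)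
    (R : forall A : T, loop_triangle X A) :
  truncated n (pretriangulated_quotient L R) <-> cluster_tilting X n.+1.
Proof.
rewrite truncatedP; split=> [XS|[_ perpP _] A]; last first.
  exact/perpP/(suspension_left_perp X_rigid (leqnn n)).
split=> // A; split=> [XA B i XB ib|A_perp].
- exact: X_rigid.
- have [B isoB] := left_perp_suspension X_rigid L R (leqnn n) A_perp.
  exact: subob_quotient_iso isoB (XS B).
- exact: X_rigid.
- exact: (right_perp_subob X_rigid (leqnn n) A_perp (XS A)).
Qed.
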